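(* Let $(X,T)$ be a topological dynamical system and let $f\in C(X)$ be a continuous real-valued function. Then $$PFK(X,T,f)=P(X,T,f),$$ where $PFK(X,T,f)$ is the topological pressure with respect to the Feldman-Katok metric and $P(X,T,f)$ is the classical topological pressure.
   Context: A topological dynamical system (TDS) is a pair $(X,T)$ where $X$ is a compact metric space with metric $d$ and $T:X\to X$ is a continuous map. Feldman-Katok metric. Let $n\geq1$ be an integer and $\delta>0$. For $x,y\in X$, an $(n,\delta)$-match of $x$ and $y$ is an order preserving bijection $\pi:D(\pi)\to R(\pi)$ (i.e. $\pi(i)<\pi(j)$ whenever $i<j$) with $D(\pi),R(\pi)\subset\{0,1,\ldots,n-1\}$ such that $d(T^ix,T^{\pi(i)}y)<\delta$ for every $i\in D(\pi)$. Let $|\pi|$ be the cardinality of $D(\pi)$ (the empty match, with $|\pi|=0$, is allowed). Put $$\bar f_{n,\delta}(x,y)=1-\frac{\max\{|\pi|:\pi\text{ is an }(n,\delta)\text{-match of }x\text{ and }y\}}{n},\qquad d_{FK_n}(x,y)=\inf\{\delta>0:\bar f_{n,\delta}(x,y)<\delta\}.$$ For $\epsilon>0$, a set $E\subset X$ is an FK-$(n,\epsilon)$-spanning set of $X$ if for every $x\in X$ there is $y\in E$ with $d_{FK_n}(x,y)\leq\epsilon$. Define $$FKsp_{n,\epsilon}(X,T,f)=\inf\Big\{\sum_{x\in F}e^{\sum_{i=0}^{n-1}f(T^ix)}:F\text{ is an FK-}(n,\epsilon)\text{-spanning set of }X\Big\},$$ $$PFK(X,T,f)=\lim_{\epsilon\to0}\limsup_{n\to\infty}\frac1n\log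 FKsp_{n,\epsilon}(X,T,f).$$ Classical pressure. Let $d_n(x,y)=\max_{0\leq i\leq n-1}d(T^ix,T^iy)$. A set $F\subset X$ is an $(n,\epsilon)$-spanning set of $X$ if for every $x\in X$ there is $y\in F$ with $d_n(x,y)\leq\epsilon$. Let $$sp_{n,\epsilon}(X,T,f)=\inf\Big\{\sum_{x\in F}e^{\sum_{i=0}^{n-1}f(T^ix)}:F\text{ is an }(n,\epsilon)\text{-spanning set of }X\Big\},$$ $$P(X,T,f)=\lim_{\epsilon\to0}\limsup_{n\to\infty}\frac1n\log sp_{n,\epsilon}(X,T,f).$$ *)

(* Defs.v *)
From HB Require Import structures.
From mathcomp Require Import all_boot all_order all_algebra.
From mathcomp Require Import all_classical all_reals all_analysis.

Set Implicit Arguments.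
Unset Strict Implicit.
Unset Printing Implicit Defensive.

Import Order.TTheory GRing.Theory Num.Theory.
Import numFieldNormedType.Exports.

Local Open Scope classical_set_scope.
Local Open Scope ring_scope.

(* An order preserving bijection pi : D(pi) -> R(pi) between subsets of
   {0, .., n-1} is encoded as a pair (D, p): D is D(pi), and p is any extension
   of pi to 'I_n. The range R(pi) is p @: D, and injectivity on D follows from
   strict monotonicity. The cardinality |pi| is #|D|. *)
Definition is_match (R : realType) (X : metricType R) (T : X -> X)
    (n : nat) (delta : R) (x y : X)
    (D : {set 'I_n}) (p : {ffun 'I_n -> 'I_n}) : bool :=
  [forall i in D, forall j in D, (i < j)%N ==> (p i < p j)%N] &&
  [forall i in D, mdist (iter i T x) (iter (p i) T y) < delta].

Definition max_match (R : realType) (X : metricType R) (T : X -> X)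
    (n : nat) (delta : R) (x y : X) : nat :=
  \max_(m : {set 'I_n} * {ffun 'I_n -> 'I_n} |
        is_match T delta x y m.1 m.2) #|m.1|.

Definition fbar (R : realType) (X : metricType R) (T : X -> X)
    (n : nat) (delta : R) (x y : X) : R :=
  1 - (max_match T n delta x y)%:R / n%:R.

(* The set is nonempty (fbar is at most 1) and bounded below by 0, so the real
   infimum is the genuine one. *)
Definition dFK (R : realType) (X : metricType R) (T : X -> X)
    (n : nat) (x y : X) : R :=
  inf [set delta : R | 0 < delta /\ fbar T n delta x y < delta].

(* Distances are nonnegative, so the default value 0 does not affect the
   maximum when n >= 1. *)
Definition bowen_dist (R : realType) (X : metricType R) (T : X -> X)
    (n : nat) (x y : X) : R :=
  \big[Num.max/0]_(i < n) mdist (iter i T x) (iter i T y).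

Definition spanning (R : realType) (X : metricType R) (dist : X -> X -> R)
    (eps : R) (F : set X) : Prop :=
  forall x : X, exists2 y, F y & dist x y <= eps.

Definition birkhoff_sum (R : realType) (X : metricType R) (T : X -> X)
    (f : X -> R) (n : nat) (x : X) : R :=
  \sum_(i < n) f (iter i T x).

(* F is not required to be finite: the sum of positive terms is taken in
   [0, +oo]. *)
Definition exp_weight (R : realType) (X : metricType R) (T : X -> X)
    (f : X -> R) (n : nat) (F : set X) : \bar R :=
  \esum_(x in F) (expR (birkhoff_sum T f n x))%:E.

Definition sp_ (R : realType) (X : metricType R) (T : X -> X) (f : X -> R)
    (n : nat) (eps : R) : \bar R :=
  ereal_inf [set exp_weight T f n F | F in spanning (bowen_dist T n) eps].

Definition FKsp (R : realType) (X : metricType R) (T : X -> X) (f : X -> R)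
    (n : nat) (eps : R) : \bar R :=
  ereal_inf [set exp_weight T f n F | F in spanning (dFK T n) eps].

(* The term of index n = 0 is 0 (as 0^-1 = 0), and is irrelevant to the
   limit superior. *)
Definition growth_rate (R : realType) (s : nat -> \bar R) : \bar R :=
  limn_esup (fun n => (n%:R^-1)%:E * lne (s n))%E.

Definition pressure (R : realType) (X : metricType R) (T : X -> X)
    (f : X -> R) : \bar R :=
  lim (growth_rate (fun n => sp_ T f n eps) @[eps --> 0^'+]).

Definition FKpressure (R : realType) (X : metricType R) (T : X -> X)
    (f : X -> R) : \bar R :=
  lim (growth_rate (fun n => FKsp T f n eps) @[eps --> 0^'+]).

(* The limits as eps --> 0^'+ exist in [-oo, +oo]: the growth rates are
   nonincreasing in eps. *)
Lemma growth_rate_is_cvg (R : realType) (X : metricType R) (T : X -> X)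
    (f : X -> R) (dist : nat -> X -> X -> R) :
  cvg (growth_rate (fun n => ereal_inf
         [set exp_weight T f n F | F in spanning (dist n) eps])
       @[eps --> 0^'+]).
Proof.
apply: nonincreasing_at_right_is_cvge; near=> a => e1 e2 _ _ e12.
rewrite /growth_rate /limn_esup !limf_esupE.
set u := fun n : nat => _; set v := fun n : nat => _.
have uv n : (u n <= v n)%E.
  rewrite /u /v; apply: lee_wpmul2l; first by rewrite lee_fin invr_ge0.
  have w0 e : (0 <= ereal_inf
      [set exp_weight T f n F | F in spanning (dist n) e])%E.
    apply: le_ereal_inf_tmp => _ [F _ <-]; apply: esum_ge0 => x _.
    by rewrite lee_fin expR_ge0.
  rewrite lee_lne ?in_itv/= ?w0 ?leey//.
  apply: ereal_inf_le_tmp => _ [F sF <-]; exists F => // x.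
  by have [y Fy xy] := sF x; exists y => //; exact: le_trans xy e12.
apply: le_ereal_inf_tmp => _ [V VF <-].
apply: (@le_trans _ _ (ereal_sup (u @` V))).
  by apply: ereal_inf_lbound; exists V.
apply: ge_ereal_sup => _ [n Vn <-].
by apply: (le_trans (uv n)); apply: ereal_sup_ubound; exists n.
Unshelve. all: by end_near. Qed.

Lemma pressure_is_cvg (R : realType) (X : metricType R) (T : X -> X)
    (f : X -> R) : cvg (growth_rate (fun n => sp_ T f n eps) @[eps --> 0^'+]).
Proof. exact: growth_rate_is_cvg. Qed.

Lemma FKpressure_is_cvg (R : realType) (X : metricType R) (T : X -> X)
    (f : X -> R) : cvg (growth_rate (fun n => FKsp T f n eps) @[eps --> 0^'+]).
Proof. exact: growth_rate_is_cvg. Qed.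

(* Main.v *)
Require Import Defs.
From HB Require Import structures.
From mathcomp Require Import all_boot all_order all_algebra.
From mathcomp Require Import all_classical all_reals all_analysis.
From mathcomp Require Import ring lra.

(** A Bowen ball of radius e is contained in the Feldman-Katok ball of the same
    radius, because the identity is a match; hence FKpressure <= pressure.

    For the converse, it is enough to show that for every e, k > 0 and all
    small enough d, sp_ n e <= exp(k n) * FKsp n d for every n > 0
    ([sp_le_FKsp]): one divides logarithms by n, takes the limit superior, and
    lets d, then k, then e tend to 0. Let F be FK-(n, d)-spanning. A point x
    that is FK-close to y in F comes with a match p of domain D missing only a
    small proportion of the times 0, ..., n-1. Fix a finite labelling of X
    whose classes have diameter less than e. Given y, record about x: the set
    D, the range of p, and for each time i outside D the label of T^i x. This
    is a word of length n over a finite alphabet. It determines x up to e in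
    the Bowen distance ([coded_by_close]): an increasing map is determined by
    its domain and its range, so two points with the same word follow the same
    piece of the orbit of y on D, and have the same labels off D. All but a
    small proportion of the letters of the word are the single letter meaning
    that i belongs both to the domain and to the range, and there are only
    exp(small * n) such words ([few_defects_words]). Choosing one point for each
    pair of a y in F and such a word gives an (n, e)-spanning set. The Birkhoff
    sums of the chosen points exceed those of y by at most small * n
    ([coded_by_birkhoff_sum]): on D by uniform continuity of f, elsewhere
    because f is bounded and few times are concerned. *)

Import Order.TTheory GRing.Theory Num.Theory.
Import numFieldNormedType.Exports.

Set Implicit Arguments.
Unset Strict Implicit.
Unset Printing Implicit Defensive.

Local Open Scope classical_set_scope.
Local Open Scope ring_scope.

(** * Words with few defects, increasing maps *)

Definition defects (A : finType) (a0 : A) (n : nat) (g : {ffun 'I_n -> A}) :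
  {set 'I_n} := [set i | g i != a0]%SET.

(** An entropy estimate by weights rather than by binomial coefficients: give
    the letter a0 weight 1 and the others weight exp(-s). A word with at most
    t n defects weighs at least exp(-s t n), whereas the total weight of the
    words of length n is the n-th power of the total weight of the letters,
    which is close to 1 for large s. *)
Lemma few_defects_words (R : realType) (A : finType) (a0 : A) (k : R) :
  0 < k -> exists2 t : R, 0 < t & forall n : nat,
    #|[set g : {ffun 'I_n -> A} | #|defects a0 g|%:R <= t * n%:R]%SET|%:R <=
    expR (k * n%:R).
Proof.
move=> k0.
have A0 : 0 < #|A|%:R :> R by rewrite ltr0n; apply/card_gt0P; exists a0.
pose s : R := 2 * #|A|%:R / k.
have s0 : 0 < s by rewrite divr_gt0// mulr_gt0.
exists (k / (2 * s)) => [|n]; first by rewrite divr_gt0// mulr_gt0.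
(* A defect is penalised by the factor exp(-s), with s so large that all the
   defective letters together weigh at most k / 2. *)
pose w (a : A) : R := expR (- s * (a != a0)%:R).
have sumw : \sum_a w a <= expR (k / 2).
  rewrite (bigD1 a0)//= /w eqxx mulr0 expR0.
  rewrite (le_trans _ (expR_ge1Dx _))// lerD2l.
  apply: (@le_trans _ _ (\sum_(a : A) (expR s)^-1)).
    rewrite [leRHS](bigD1 a0)//= -[leLHS]add0r lerD//.
    by apply: ler_sum => a ->; rewrite mulr1 expRN.
  rewrite sumr_const -[leLHS]mulr_natl ler_pdivrMr ?expR_gt0//.
  apply: (@le_trans _ _ (k / 2 * s)).
    by rewrite le_eqVlt /s; apply/orP; left; apply/eqP; field; rewrite gt_eqF.
  rewrite ler_wpM2l ?divr_ge0 ?(ltW k0)//.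
  by rewrite (le_trans _ (expR_ge1Dx _))// lerDr.
have wE (g : {ffun 'I_n -> A}) :
    \prod_i w (g i) = expR (- s * #|defects a0 g|%:R).
  rewrite /w -expR_sum -mulr_sumr; congr (expR (_ * _)).
  rewrite -natr_sum -sum1_card [in RHS]big_mkcond.
  by congr (_%:R); apply: eq_bigr => i _; rewrite inE.
rewrite -sum1_card natr_sum.
apply: (@le_trans _ _
    (\sum_(g : {ffun 'I_n -> A}) expR (k / 2 * n%:R) * \prod_i w (g i))).
  rewrite big_mkcond; apply: ler_sum => g _; case: ifPn => [|_].
    rewrite inE => gd; rewrite wE -expRD -[leLHS]expR0 ler_expR mulNr subr_ge0.
    apply: le_trans (ler_wpM2l (ltW s0) gd) _.
    rewrite le_eqVlt; apply/orP; left; apply/eqP; field; rewrite gt_eqF//.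
  by rewrite mulr_ge0 ?expR_ge0// prodr_ge0// => i _; rewrite expR_ge0.
rewrite -mulr_sumr -(bigA_distr_bigA (fun _ => w)) prodr_const card_ord.
have -> : k * n%:R = k / 2 * n%:R + k / 2 * n%:R by rewrite -mulrDl -splitr.
rewrite expRD ler_wpM2l ?expR_ge0// expRM_natr lerXn2r// ?nnegrE ?expR_ge0//.
by rewrite sumr_ge0// => a _; rewrite expR_ge0.
Qed.

(** The smallest point of D where p and q differ would give a contradiction:
    if p i < q i there, then p i is taken by q at an earlier point, where p and
    q agree, against the injectivity of p. *)
Lemma increasing_eq_image (n : nat) (D : {set 'I_n}) (p q : 'I_n -> 'I_n) :
    {in D &, {homo p : i j / (i < j)%N}} ->
    {in D &, {homo q : i j / (i < j)%N}} ->
  p @: D = q @: D -> {in D, p =1 q}.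
Proof.
wlog suff wl : p q / {in D &, {homo p : i j / (i < j)%N}} ->
    {in D &, {homo q : i j / (i < j)%N}} -> p @: D = q @: D ->
    forall i, i \in D -> (forall j, j \in D -> (j < i)%N -> p j = q j) ->
    ~ (p i < q i)%N.
  move=> incp incq pq i; have [m] := ubnP (val i).
  elim: m i => // m IH i im iD.
  have eq_lt j : j \in D -> (j < i)%N -> p j = q j.
    by move=> jD ji; apply: IH => //; exact: leq_trans ji im.
  apply: ord_inj; apply/eqP; rewrite eqn_leq (leqNgt (p i)) (leqNgt (q i)).
  apply/andP; split.
    apply/negP; apply: (wl q p incq incp (esym pq) i iD) => j jD.
    by move=> /(eq_lt j jD).
  by apply/negP; apply: (wl p q incp incq pq i iD eq_lt).
move=> incp incq pq i iD eq_lt piqi.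
have /imsetP[j jD pij] : p i \in q @: D by rewrite -pq imset_f.
have [ij|ji|/ord_inj ij] := ltngtP i j.
- by have := incq _ _ iD jD ij; rewrite -pij ltnNge ltnW.
- by have := incp _ _ jD iD ji; rewrite eq_lt// -pij ltnn.
- by move: piqi; rewrite pij ij ltnn.
Qed.

Lemma increasing_inj (n : nat) (D : {set 'I_n}) (p : 'I_n -> 'I_n) :
  {in D &, {homo p : i j / (i < j)%N}} -> {in D &, injective p}.
Proof.
move=> inc i j iD jD pij; apply: ord_inj.
have [ij|ji|//] := ltngtP i j.
- by have := inc _ _ iD jD ij; rewrite pij ltnn.
- by have := inc _ _ jD iD ji; rewrite pij ltnn.
Qed.

(** * Sums of nonnegative terms over images and products *)

(** The inequality comes from the points of e @` P with several preimages: a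
    section of e keeps one of them. *)
Lemma esum_image_le (R : realType) (I J : choiceType) (P : set I) (e : I -> J)
    (a : J -> \bar R) :
  (\esum_(j in e @` P) a j <= \esum_(i in P) a (e i))%E.
Proof.
have [->|/set0P[i0 Pi0]] := eqVneq P set0.
  by rewrite image_set0 !esum_set0.
pose h j := xget i0 (P `&` e @^-1` [set j]).
have hP j : (e @` P) j -> P (h j) /\ e (h j) = j.
  by move=> [i Pi eij]; apply: (@xgetPex _ i0 (P `&` e @^-1` [set j])); exists i.
rewrite (eq_esum (b := fun j => a (e (h j)))); last by move=> j /hP[_ ->].
rewrite -(esum_image _ h (fun i => a (e i))); last first.
  move=> j k /[!inE] /hP[_ hj] /hP[_ hk] hjk.
  by rewrite -hj hjk.
apply: ge_ereal_sup => _ [Y [finY YS] <-]; apply: esum_ge; exists Y => //.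
by split => // i /YS[j /hP[? _] <-].
Qed.

Lemma esumZl_le (R : realType) (I : choiceType) (F : set I) (c : R)
    (a : I -> \bar R) : 0 <= c -> (forall i, 0 <= a i)%E ->
  (\esum_(i in F) (c%:E * a i) <= c%:E * \esum_(i in F) a i)%E.
Proof.
move=> c0 a0; apply: ge_ereal_sup => _ [Y YF <-].
rewrite -ge0_mule_fsumr//; apply: lee_wpmul2l; first by rewrite lee_fin.
by apply: esum_ge; exists Y.
Qed.

(** The cost of replacing a spanning set by another: F is to be spanning, P the
    set of codes, and e i g the point chosen for the pair of i and g. *)
Lemma esum_image_setX_le (R : realType) (I J : choiceType) (K : finType)
    (F : set I) (P : {set K}) (c : R) (e : I -> K -> J) (w : J -> \bar R)
    (a : I -> \bar R) :
    (forall i, 0 <= a i)%E ->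
    0 <= c -> (forall i g, g \in P -> w (e i g) <= c%:E * a i)%E ->
  (\esum_(j in [set e ig.1 ig.2 | ig in F `*` [set` P]]) w j <=
   (#|P|%:R * c)%:E * \esum_(i in F) a i)%E.
Proof.
move=> a0 c0 wa; have ca0 i : (0 <= c%:E * a i)%E by rewrite mule_ge0 ?lee_fin.
apply: (@le_trans _ _ (\esum_(ig in F `*` [set` P]) w (e ig.1 ig.2))%E).
  exact: (esum_image_le _ (fun ig : I * K => e ig.1 ig.2)).
apply: (@le_trans _ _ (\esum_(ig in F `*` [set` P]) (c%:E * a ig.1))%E).
  by apply: le_esum => -[i g] /= [_ gP]; exact: wa.
rewrite -(@esum_esum _ _ _ F (fun=> [set` P]) (fun i _ => c%:E * a i)%E)//.
rewrite (eq_esum (b := fun i => (\sum_(g in P) (c%:E * a i))%E)); last first.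
  move=> i Fi; rewrite esum_fset// -big_enum/= [RHS]fsbig_seq ?enum_uniq//.
  by apply: eq_fsbigl; apply/seteqP; split => g /=; rewrite mem_enum.
rewrite esum_sum// sumr_const -[leLHS]/(enatmul _ _) -mule_natl EFinM.
rewrite -muleA lee_wpmul2l ?lee_fin//.
exact: esumZl_le.
Qed.

(** * Compact metric spaces *)

Lemma mdist_triangle2 (R : realType) (X : metricType R) (e : R) (y x z : X) :
  mdist x y < e / 2 -> mdist y z < e / 2 -> mdist x z < e.
Proof.
move=> xy yz; apply: le_lt_trans (metric_triangle x y z) _.
by rewrite [ltRHS]splitr ltrD.
Qed.

(** Compactness as near-covering: the finite sequences, directed by inclusion,
    form the filter; a sequence containing x works near x. *)
Lemma compact_finite_net (R : realType) (X : metricType R) (e : R) :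
  compact [set: X] -> 0 < e ->
  exists c : seq X, forall x, exists2 z, z \in c & mdist z x < e.
Proof.
move=> /compact_near_coveringP cX e0.
pose F : set_system (seq X) :=
  filter_from [set: seq X] (fun c => [set c' : seq X | {subset c <= c'}]).
have FF : Filter F.
  apply: filter_from_filter; first by exists [::].
  move=> c c' _ _; exists (c ++ c') => // c'' /= cc'.
  by split=> z zc; apply: cc'; rewrite mem_cat zc ?orbT.
have [x _|c _ cP] := cX _ F (fun c x => exists2 z, z \in c & mdist z x < e) FF.
  exists (ball x e, [set c : seq X | {subset [:: x] <= c}]) => /=.
    by split; [exact: nbhsx_ballx|exists [:: x]].
  move=> [x' c] [/=]; rewrite ballEmdist => xx' xc.
  by exists x => //; apply: xc; rewrite inE.
by exists c => x; apply: (cP c).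
Qed.

(** A partition into finitely many small pieces: label x by the index of the
    first point of a finite net near x. *)
Lemma compact_labelling (R : realType) (X : metricType R) (e : R) :
  compact [set: X] -> 0 < e ->
  exists (N : nat) (lab : X -> 'I_N.+1),
    forall x y, lab x = lab y -> mdist x y < e.
Proof.
move=> cX e0; have e20 : 0 < e / 2 by rewrite divr_gt0.
have [c cov] := compact_finite_net cX e20.
pose P (x : X) := fun z : X => mdist z x < e / 2.
have hasP x : has (P x) c by apply/hasP; exact: cov.
(* Every index found is less than size c; the successor keeps the type of
   labels inhabited, as inord needs. *)
exists (size c), (fun x => inord (find (P x) c)) => x y.
have sz z : (find (P z) c < (size c).+1)%N by rewrite ltnS find_size.
move=> /(congr1 val); rewrite /= !inordK// => xy.
have /= Px := nth_find x (hasP x); have /= Py := nth_find x (hasP y).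
apply: mdist_triangle2 Py; rewrite metric_sym; move: Px; rewrite xy.
exact.
Qed.

Lemma compact_unif_continuous (R : realType) (X : metricType R) (f : X -> R)
    (e : R) :
  compact [set: X] -> continuous f -> 0 < e ->
  exists2 d : R, 0 < d & forall x y, mdist x y < d -> `|f x - f y| < e.
Proof.
move=> /compact_near_coveringP cX cf e0.
have e20 : 0 < e / 2 by rewrite divr_gt0.
have : \forall d \near 0^'+, [set: X] `<=`
    [set x | forall y, mdist x y < d -> `|f x - f y| < e].
  apply: cX => x _.
  have /cvgrPdist_lt/(_ _ e20) := cf x.
  move=> /nbhs_ballP[r /= r0]; rewrite ballEmdist => xr.
  exists (ball x (r / 2), [set d | d < r / 2]) => /=.
    split; first by apply: nbhsx_ballx; rewrite divr_gt0.
    by apply: nbhs_right_lt; rewrite divr_gt0.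
  move=> [x' d] [/=]; rewrite ballEmdist /= => xx' dr y x'y.
  rewrite (@distm_lt_split _ _ (f x))//.
    by rewrite distrC xr//= (lt_trans xx')// ltr_pdivrMr// ltr_pMr// ltr1n.
  by apply: xr; apply: mdist_triangle2 xx' (lt_trans x'y dr).
move=> [r /= r0 Hr]; exists (r / 2) => [|x y xy]; first by rewrite divr_gt0.
apply: (Hr (r / 2)) xy; rewrite ?divr_gt0//=.
by rewrite sub0r normrN gtr0_norm ?divr_gt0// ltr_pdivrMr// ltr_pMr// ltr1n.
Qed.

Lemma compact_continuous_bounded (R : realType) (X : metricType R)
    (f : X -> R) :
  compact [set: X] -> continuous f ->
  exists2 M : R, 0 < M & forall x, `|f x| <= M.
Proof.
move=> cX cf.
have : bounded_set (f @` [set: X]).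
  apply: compact_bounded; apply: continuous_compact => //.
  exact: continuous_subspaceT.
move=> [M [_ HM]]; exists (Num.max M 0 + 1).
  by rewrite ltr_wpDl// le_max lexx orbT.
move=> x; apply: (HM (Num.max M 0 + 1)); last by exists x.
by rewrite ltr_pwDr// le_max lexx.
Qed.

(** * Matches, Bowen distance and Feldman-Katok distance *)

Lemma is_match_incr (R : realType) (X : metricType R) (T : X -> X) (n : nat)
    (d : R) (x y : X) (D : {set 'I_n}) (p : {ffun 'I_n -> 'I_n}) :
  is_match T d x y D p -> {in D &, {homo p : i j / (i < j)%N}}.
Proof.
move=> /andP[/forall_inP inc _] i j iD jD.
by move: (inc i iD) => /forall_inP/(_ j jD)/implyP.
Qed.

Lemma is_match_mdist (R : realType) (X : metricType R) (T : X -> X) (n : nat)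
    (d : R) (x y : X) (D : {set 'I_n}) (p : {ffun 'I_n -> 'I_n}) :
  is_match T d x y D p ->
  {in D, forall i : 'I_n, mdist (iter i T x) (iter (p i) T y) < d}.
Proof. by move=> /andP[_ /forall_inP]. Qed.

(** The infimum in dFK provides some e < d with fbar at e less than e; a maximum
    match for e is a match for d. *)
Lemma dFK_lt_match (R : realType) (X : metricType R) (T : X -> X) (n : nat)
    (d : R) (x y : X) : (0 < n)%N -> dFK T n x y < d ->
  exists (D : {set 'I_n}) (p : {ffun 'I_n -> 'I_n}),
    is_match T d x y D p /\ #|~: D|%:R <= d * n%:R.
Proof.
move=> n0 /inf_lt[|e [e0 fe] ed].
  exists 2; split=> //; rewrite /fbar.
  by rewrite (@le_lt_trans _ _ 1) ?ltr1n// gerBl divr_ge0.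
have [|[D p] mDp maxE] := @eq_bigmax_cond _
    (fun m : {set 'I_n} * {ffun 'I_n -> 'I_n} => is_match T e x y m.1 m.2)
    (fun m => #|m.1|).
  apply/card_gt0P; exists (finset.set0, [ffun i => i]).
  by apply/andP; split; apply/forall_inP => i; rewrite finset.in_set0.
exists D, p; split.
  move: mDp => /andP[/= inc /forall_inP Dp]; rewrite /is_match inc/=.
  by apply/forall_inP => i iD; rewrite (lt_trans (Dp i iD)).
move: fe; rewrite /fbar /max_match maxE/= => fe.
have -> : #|~: D|%:R = (1 - #|D|%:R / n%:R) * n%:R :> R.
  rewrite mulrBl mul1r divfK ?pnatr_eq0 -?lt0n// -natrB; last first.
    by rewrite -[leqRHS]card_ord max_card.
  by rewrite cardsCs finset.setCK card_ord.
by rewrite ler_wpM2r// ltW// (lt_trans fe).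
Qed.

Lemma le_bowen_dist (R : realType) (X : metricType R) (T : X -> X) (n : nat)
    (e : R) (x y : X) : 0 <= e ->
  (bowen_dist T n x y <= e) =
  [forall i : 'I_n, mdist (iter i T x) (iter i T y) <= e].
Proof.
move=> e0; apply/idP/forallP => [xy i|xy].
  by apply: le_trans xy; apply: le_bigmax.
by apply: bigmax_le => // i _.
Qed.

(** The identity is a match of size n as soon as its radius exceeds the Bowen
    distance. *)
Lemma dFK_le_bowen_dist (R : realType) (X : metricType R) (T : X -> X)
    (n : nat) (x y : X) : (0 < n)%N -> dFK T n x y <= bowen_dist T n x y.
Proof.
move=> n0; apply/ler_addgt0Pr => e e0.
have b0 : 0 <= bowen_dist T n x y by apply: bigmax_ge_id.
apply: ge_inf; first by exists 0 => d [/ltW].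
split; first by rewrite ltr_wpDl.
have m_id : is_match T (bowen_dist T n x y + e) x y [set: 'I_n]%SET [ffun i => i].
  apply/andP; split; apply/forall_inP => i _.
    by apply/forall_inP => j _; rewrite !ffunE implybb.
  rewrite ffunE (@le_lt_trans _ _ (bowen_dist T n x y)) ?ltrDl//.
  by have := le_bowen_dist T n x y b0; rewrite lexx => /esym/forallP.
rewrite /fbar (@le_lt_trans _ _ 0) ?ltr_wpDl// subr_le0.
rewrite ler_pdivlMr ?ltr0n// mul1r ler_nat /max_match.
pose F (m : {set 'I_n} * {ffun 'I_n -> 'I_n}) := #|m.1|.
apply: leq_trans _ (@leq_bigmax_cond _ _ F ([set: 'I_n]%SET, [ffun i => i]) m_id).
by rewrite /F /= cardsT card_ord.
Qed.

(** The sum over D is compared with the sum of f along the orbit of y at the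
    times p @: D; the times left over on either side cost at most M each. *)
Lemma birkhoff_sum_match (R : realType) (X : metricType R) (T : X -> X)
    (f : X -> R) (M h : R) (n : nat) (x y : X) (D : {set 'I_n})
    (p : 'I_n -> 'I_n) :
    (forall z, `|f z| <= M) -> {in D &, injective p} -> 0 <= h ->
    {in D, forall i : 'I_n, f (iter i T x) <= f (iter (p i) T y) + h} ->
  birkhoff_sum T f n x <=
  birkhoff_sum T f n y + h * n%:R + M * #|~: D|%:R + M * #|~: (p @: D)|%:R.
Proof.
move=> fM injp h0 fxy.
pose F z (i : 'I_n) := f (iter i T z).
have bsE (A : {set 'I_n}) z : birkhoff_sum T f n z =
    \sum_(i in A) F z i + \sum_(i in ~: A) F z i.
  rewrite /birkhoff_sum (bigID (mem A))/=; congr (_ + _).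
  by apply: eq_bigl => i; rewrite inE.
have boundM (A : {set 'I_n}) z : `|\sum_(i in A) F z i| <= M * #|A|%:R.
  rewrite (le_trans (ler_norm_sum _ _ _))// mulr_natr -sumr_const.
  by apply: ler_sum => i _; exact: fM.
have onD : \sum_(i in D) F x i <= \sum_(j in p @: D) F y j + h * n%:R.
  rewrite big_imset//= (@le_trans _ _ (\sum_(i in D) (F y (p i) + h)))//.
    by apply: ler_sum => i; exact: fxy.
  rewrite big_split/= lerD2l sumr_const -[leLHS]mulr_natr ler_wpM2l// ler_nat.
  by rewrite -[leqRHS]card_ord max_card.
rewrite (bsE D x) (bsE (p @: D) y).
have := ler_norm (\sum_(i in ~: D) F x i).
have := ler_norm (- \sum_(i in ~: (p @: D)) F y i).
have := boundM (~: D) x; have := boundM (~: (p @: D)) y; rewrite normrN.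
by lra.
Qed.

(** * Coding a point by a word relative to a point matched with it *)

(** A letter at time i is a pair: None if i belongs to the domain of the match
    and Some label of T^i x otherwise; and whether i belongs to its range. *)
Definition code_dom (L : finType) (n : nat)
    (g : {ffun 'I_n -> option L * bool}) : {set 'I_n} :=
  [set i | (g i).1 == None]%SET.

Definition code_range (L : finType) (n : nat)
    (g : {ffun 'I_n -> option L * bool}) : {set 'I_n} :=
  [set i | (g i).2]%SET.

Definition coded_by (R : realType) (X : metricType R) (T : X -> X)
    (L : finType) (lab : X -> L) (n : nat) (d : R) (y : X)
    (g : {ffun 'I_n -> option L * bool}) : set X :=
  [set x | exists p : {ffun 'I_n -> 'I_n},
    [/\ is_match T d x y (code_dom g) p,
        p @: code_dom g = code_range g &
        forall (i : 'I_n) l, (g i).1 = Some l -> lab (iter i T x) = l]].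

(** A word has a defect at i when i is missing from the domain or from the range
    of the match, and these two sets have the same cardinality. *)
Lemma match_coded_by (R : realType) (X : metricType R) (T : X -> X)
    (L : finType) (lab : X -> L) (n : nat) (d : R) (x y : X) (D : {set 'I_n})
    (p : {ffun 'I_n -> 'I_n}) : is_match T d x y D p ->
  exists2 g : {ffun 'I_n -> option L * bool},
    coded_by T lab d y g x & (#|defects (None, true) g| <= 2 * #|~: D|)%N.
Proof.
move=> mDp.
pose g : {ffun 'I_n -> option L * bool} :=
  [ffun i : 'I_n => (if i \in D then None else Some (lab (iter i T x)),
                     i \in p @: D)].
have domE : code_dom g = D.
  by apply/setP => i; rewrite inE ffunE /=; case: ifP.
have rangeE : code_range g = p @: D by apply/setP => i; rewrite inE ffunE.
exists g.
  exists p; rewrite domE rangeE; split=> // i l.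
  by rewrite ffunE/=; case: ifP => // _ [].
have dE : defects (None, true) g = ~: D :|: ~: (p @: D).
  apply/setP => i; rewrite !inE ffunE; case: (i \in D) => //=.
  by case: (i \in _).
rewrite dE (leq_trans (leq_card_setU _ _))// mul2n -addnn leq_add2l.
rewrite [leqLHS]cardsCs [leqRHS]cardsCs !finset.setCK card_in_imset//.
exact: increasing_inj (is_match_incr mDp).
Qed.

(** Both points are matched with y by the same increasing map, because it is
    determined by its domain and range; so they are close at the times of the
    domain by the triangle inequality, and at the other times by their labels. *)
Lemma coded_by_close (R : realType) (X : metricType R) (T : X -> X)
    (L : finType) (lab : X -> L) (n : nat) (d e : R) (y : X)
    (g : {ffun 'I_n -> option L * bool}) (x x' : X) : 0 < e -> d <= e / 2 ->
    (forall u v, lab u = lab v -> mdist u v < e) ->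
    coded_by T lab d y g x -> coded_by T lab d y g x' ->
  bowen_dist T n x x' <= e.
Proof.
move=> e0 de labe [p [mp pR px]] [p' [mp' p'R px']].
rewrite le_bowen_dist ?ltW//; apply/forallP => i; apply/ltW.
case gi : (g i).1 => [l|]; first by apply: labe; rewrite (px i l gi) (px' i l gi).
have iD : i \in code_dom g by rewrite inE gi.
have := is_match_mdist mp iD; have := is_match_mdist mp' iD.
have -> : p' i = p i.
  apply: increasing_eq_image iD.
  - exact: is_match_incr mp'.
  - exact: is_match_incr mp.
  - by rewrite pR.
rewrite metric_sym => x'y xy.
by apply: (@mdist_triangle2 _ _ _ (iter (p i) T y)); apply: lt_le_trans de.
Qed.

Lemma coded_by_birkhoff_sum (R : realType) (X : metricType R) (T : X -> X)
    (L : finType) (lab : X -> L) (f : X -> R) (M h d : R) (n : nat) (y : X)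
    (g : {ffun 'I_n -> option L * bool}) (x : X) :
    (forall z, `|f z| <= M) -> 0 <= h ->
    (forall u v, mdist u v < d -> `|f u - f v| < h) ->
    coded_by T lab d y g x ->
  birkhoff_sum T f n x <=
  birkhoff_sum T f n y + h * n%:R + 2 * M * #|defects (None, true) g|%:R.
Proof.
move=> fM h0 fh [p [mp pR px]].
have M0 : 0 <= M by apply: le_trans (fM x).
have injp := increasing_inj (is_match_incr mp).
apply: le_trans (birkhoff_sum_match fM injp h0 _) _.
  move=> i iD; rewrite -lerBlDl ltW// (le_lt_trans (ler_norm _))// fh//.
  exact: is_match_mdist mp i iD.
rewrite -[2 * M * _]mulrA mulr_natl mulr2n.
rewrite -addrA lerD2l pR; apply: lerD; apply: ler_wpM2l => //; rewrite ler_nat;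
  apply/subset_leq_card/fintype.subsetP => i; rewrite !inE;
  by apply: contraNneq => ->.
Qed.

(** * Comparison of the partition sums, growth rates and pressures *)

Lemma FKsp_le_sp (R : realType) (X : metricType R) (T : X -> X) (f : X -> R)
    (d : R) (n : nat) : (0 < n)%N -> (FKsp T f n d <= sp_ T f n d)%E.
Proof.
move=> n0; apply: ereal_inf_le_tmp => _ [F spF <-]; exists F => // x.
have [y Fy xy] := spF x; exists y => //.
exact: le_trans (dFK_le_bowen_dist T x y n0) xy.
Qed.

(** Replace each y of an FK-spanning set by one point for each word with few
    defects that codes some point relative to y. *)
Lemma sp_le_FKsp (R : realType) (X : metricType R) (T : X -> X) (f : X -> R)
    (e k : R) : compact [set: X] -> continuous f -> 0 < e -> 0 < k ->
  exists2 d0, 0 < d0 & forall (d : R) (n : nat), d < d0 -> (0 < n)%N ->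
    (sp_ T f n e <= (expR (k * n%:R))%:E * FKsp T f n d)%E.
Proof.
move=> cX cf e0 k0.
have [N [lab labe]] := compact_labelling cX e0.
have [M M0 fM] := compact_continuous_bounded cX cf.
have k4 : 0 < k / 4 by rewrite divr_gt0.
have [r r0 fr] := compact_unif_continuous cX cf k4.
have k2 : 0 < k / 2 by rewrite divr_gt0.
(* Half of the rate k pays for the number of words, a quarter for the variation
   of f along matched times, and the last quarter for the defects. *)
have [t0 t00 words] :=
  @few_defects_words R (option 'I_N.+1 * bool)%type (None, true) _ k2.
pose t := Num.min t0 (k / (8 * M)).
have t_gt0 : 0 < t by rewrite lt_min t00 divr_gt0// mulr_gt0.
have tM : 2 * M * t <= k / 4.
  apply: (@le_trans _ _ (2 * M * (k / (8 * M)))).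
    by rewrite ler_wpM2l ?mulr_ge0 ?(ltW M0)// ge_min lexx orbT.
  rewrite le_eqVlt; apply/orP; left; apply/eqP; field; rewrite gt_eqF//.
pose d0 := Num.min (Num.min r (e / 2)) (t / 2).
have d0_gt0 : 0 < d0 by rewrite !lt_min r0 !divr_gt0.
have d0r : d0 <= r by rewrite !ge_min lexx.
have d0e : d0 <= e / 2 by rewrite !ge_min lexx orbT.
have d0t : 2 * d0 <= t.
  by rewrite mulrC -ler_pdivlMr// !ge_min lexx !orbT.
exists d0 => // d n dd0 n0.
rewrite -lee_pdivrMl ?expR_gt0//.
apply: le_ereal_inf_tmp => _ [F spF <-]; rewrite lee_pdivrMl ?expR_gt0//.
pose P := [set g : {ffun 'I_n -> option 'I_N.+1 * bool} |
            (#|defects (None, true) g|%:R <= t * n%:R)]%SET.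
have cardP : #|P|%:R <= expR (k / 2 * n%:R).
  apply: le_trans (words n); rewrite ler_nat subset_leq_card//.
  apply/fintype.subsetP => g; rewrite !inE => /le_trans; apply.
  by rewrite ler_wpM2r// ge_min lexx.
(* If no point has code g relative to y, then z y g is the default value y,
   which satisfies the weight bound below. *)
pose z (y : X) (g : {ffun 'I_n -> option 'I_N.+1 * bool}) : X :=
  xget y (coded_by T lab d0 y g).
pose G := [set z yg.1 yg.2 | yg in F `*` [set` P]].
have spG : spanning (bowen_dist T n) e G.
  move=> x; have [y Fy xy] := spF x.
  have [D [p [mDp cardD]]] := dFK_lt_match n0 (le_lt_trans xy dd0).
  have [g gx gdef] := match_coded_by lab mDp.
  exists (z y g).
    exists (y, g) => //=; split=> //=; rewrite inE.
    apply: (@le_trans _ _ (2 * #|~: D|%:R)); first by rewrite -natrM ler_nat.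
    apply: le_trans (ler_wpM2r (ler0n _ n) d0t).
    by rewrite -mulrA ler_wpM2l.
  by apply: (coded_by_close e0 d0e labe gx); apply: xgetPex; exists x.
pose C := expR (k / 2 * n%:R).
apply: (@le_trans _ _ (exp_weight T f n G)).
  by apply: ereal_inf_lbound; exists G.
apply: (@le_trans _ _ ((#|P|%:R * C)%:E * exp_weight T f n F)%E).
  apply: esum_image_setX_le => [y||y g gP]; rewrite ?expR_ge0//.
  rewrite lee_fin /C -expRD ler_expR /z.
  case: xgetP => [x _ gx|_]; last by rewrite lerDr mulr_ge0// ltW.
  apply: le_trans (coded_by_birkhoff_sum fM (ltW k4) _ gx) _.
    by move=> u v uv; apply: fr; exact: lt_le_trans uv d0r.
  rewrite -addrA [leRHS]addrC lerD2l.
  have -> : k / 2 * n%:R = k / 4 * n%:R + k / 4 * n%:R by field.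
  rewrite lerD2l; apply: le_trans (ler_wpM2r (ler0n _ n) tM).
  by rewrite -[leRHS]mulrA ler_wpM2l ?mulr_ge0 ?(ltW M0)//; move: gP; rewrite inE.
apply: lee_wpmul2r; first by apply: esum_ge0 => y _; rewrite lee_fin expR_ge0.
by rewrite lee_fin [k in leRHS]splitr mulrDl expRD ler_wpM2r// expR_ge0.
Qed.

Lemma growth_rate_le (R : realType) (k : R) (a b : nat -> \bar R) :
    (forall n, 0 <= a n)%E -> (forall n, 0 <= b n)%E ->
    (forall n, (0 < n)%N -> a n <= (expR (k * n%:R))%:E * b n)%E ->
  (growth_rate a <= k%:E + growth_rate b)%E.
Proof.
move=> a0 b0 ab.
have le_n n : (0 < n)%N ->
    ((n%:R^-1)%:E * lne (a n) <= k%:E + (n%:R^-1)%:E * lne (b n))%E.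
  move=> n0; have := ab n n0; have := b0 n.
  (* If b n = 0, then a n = 0 too and both logarithms are -oo. *)
  rewrite le_eqVlt => /predU1P[<-|bn].
    rewrite mule0 => /le0_lneNy ->; rewrite gt0_muleNy ?leNye//.
    by rewrite lte_fin invr_gt0 ltr0n.
  move=> anbn; have ebn : (0 <= (expR (k * n%:R))%:E * b n)%E.
    by rewrite mule_ge0 ?lee_fin ?expR_ge0.
  have : (lne (a n) <= (k * n%:R)%:E + lne (b n))%E.
    rewrite -[(k * n%:R)%:E]expeRK -lneM ?in_itv/= ?leey ?lte_fin ?expR_gt0 ?bn//.
    by rewrite lee_lne// in_itv/= leey ?a0 ?ebn.
  have nge0 : (0 <= (n%:R^-1)%:E :> \bar R)%E by rewrite lee_fin.
  move=> /(lee_wpmul2l nge0)/le_trans; apply.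
  rewrite muleDr// ?fin_num_adde_defr// -EFinM mulrCA mulVf ?mulr1//.
  by rewrite pnatr_eq0 -lt0n.
rewrite /growth_rate /limn_esup !limf_esupE -leeBlDl//.
apply: le_ereal_inf_tmp => _ [V VF <-]; rewrite leeBlDl//.
apply: le_trans (ereal_inf_lbound _) _.
  (* The index 0 does not count for the limit superior. *)
  exists (V `&` [set n | (0 < n)%N]) => //.
  by apply: filterI => //; exists 1%N.
apply: ge_ereal_sup => _ [n [Vn n0] <-]; apply: le_trans (le_n n n0) _.
by rewrite leeD2l//; apply: ereal_sup_ubound; exists n.
Qed.

Lemma exp_weight_inf_ge0 (R : realType) (X : metricType R) (T : X -> X)
    (f : X -> R) (n : nat) (A : set (set X)) :
  (0 <= ereal_inf [set exp_weight T f n F | F in A])%E.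
Proof.
apply: le_ereal_inf_tmp => _ [F _ <-]; apply: esum_ge0 => x _.
by rewrite lee_fin expR_ge0.
Qed.

Theorem theorem3p2 (R : realType) (X : metricType R) (T : X -> X) (f : X -> R)
    (X_compact : compact [set: X]) (T_cont : continuous T)
    (f_cont : continuous f) :
  FKpressure T f = pressure T f.
Proof.
have FK0 n d : (0 <= FKsp T f n d)%E by exact: exp_weight_inf_ge0.
have sp0 n d : (0 <= sp_ T f n d)%E by exact: exp_weight_inf_ge0.
apply/eqP; rewrite eq_le; apply/andP; split.
  apply: lee_lim; [exact: FKpressure_is_cvg|exact: pressure_is_cvg|].
  apply: nearW => d; rewrite -[leRHS]add0e; apply: growth_rate_le => // n n0.
  by rewrite mul0r expR0 mul1e; exact: FKsp_le_sp.
apply: lime_le; first exact: pressure_is_cvg.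
near=> e; apply/lee_addgt0Pr => k k0.
have e0 : 0 < e by near: e; exact: nbhs_right_gt.
have [d0 d00 sp_FK] := sp_le_FKsp T X_compact f_cont e0 k0.
rewrite addeC -leeBlDl//; apply: lime_ge; first exact: FKpressure_is_cvg.
near=> d; rewrite leeBlDl//; apply: growth_rate_le => // n n0.
by apply: sp_FK => //; near: d; exact: nbhs_right_lt.
Unshelve. all: by end_near. Qed.
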